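(* Let $n,m\geq 3$ be odd integers. Let $X$ be a finite group which is an exact product $X=HK$ of two dihedral subgroups $H=\langle x\rangle\rtimes\langle y\rangle\cong D_{2n}$ and $K=\langle z\rangle\rtimes\langle w\rangle\cong D_{2m}$, where $x,y,z,w$ have orders $n,2,m,2$ respectively. Then $X$ has, in terms of the generators $x,y,z,w$, a presentation $$X=\langle x,y,z,w\mid x^n=y^2=z^m=w^2=[x,z]=1,\ x^y=x^{-1},\ z^w=z^{-1},\ [x,w]=x^{sn_1}z^{bm_1},\ [z,y]=x^{rn_1}z^{am_1},\ [y,w]=x^{tn_1}z^{cm_1}\rangle,$$ where $m_1$ and $n_1$ are positive divisors of $m$ and $n$ respectively such that $\langle z\rangle_X=\langle z^{m_1}\rangle$ and $\langle x\rangle_X=\langle x^{n_1}\rangle$, and $a,b,c\in\mathbb{Z}_{m/m_1}$ and $r,s,t\in\mathbb{Z}_{n/n_1}$ satisfy the following conditions: (a) $a(2+am_1)\equiv b(2+am_1)\equiv c(2+am_1)\equiv 0\pmod{m/m_1}$; (b) $r(2+sn_1)\equiv s(2+sn_1)\equiv t(2+sn_1)\equiv 0\pmod{n/n_1}$; (c) for every integer $k$, $bk\equiv 0\pmod{m/m_1}$ if and only if $k\equiv 0\pmod{n_1}$; (d) for every integer $k$, $rk\equiv 0\pmod{n/n_1}$ if and only if $k\equiv 0\pmod{m_1}$.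
   Context: All groups are finite. A group $X$ is an exact product of subgroups $H$ and $K$ if $X=HK$ and $H\cap K=\{1_X\}$. $D_{2n}$ denotes the dihedral group of order $2n$, and $\mathbb{Z}_k$ the ring of integers modulo $k$. For a subgroup $L\leq X$, $L_X=\bigcap_{g\in X}g^{-1}Lg$ denotes the core of $L$ in $X$ (the largest normal subgroup of $X$ contained in $L$). Conventions: $g^h=h^{-1}gh$ and $[g,h]=g^{-1}h^{-1}gh$. In $H=\langle x\rangle\rtimes\langle y\rangle\cong D_{2n}$ the element $x$ has order $n$, $y$ has order $2$ and $x^y=x^{-1}$; similarly in $K=\langle z\rangle\rtimes\langle w\rangle\cong D_{2m}$ the element $z$ has order $m$, $w$ has order $2$ and $z^w=z^{-1}$. *)

(* Defs.v *)
From Stdlib Require List.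
From HB Require Import structures.
From mathcomp Require Import all_boot all_order all_algebra all_fingroup.

Set Implicit Arguments.
Unset Strict Implicit.
Unset Printing Implicit Defensive.

Local Open Scope group_scope.

(* Formal group words over an alphabet I. They only carry the operations
   (baseGroupType), so ^+, ^ and [~ , ] on words are the library's own. *)
Inductive word (I : Type) : Type :=
  | WGen of I
  | WOne
  | WMul of word I & word I
  | WInv of word I.
Arguments WOne {I}.

HB.instance Definition _ (I : Type) := hasMul.Build (word I) (@WMul I).
HB.instance Definition _ (I : Type) := hasOne.Build (word I) (@WOne I).
HB.instance Definition _ (I : Type) := hasInv.Build (word I) (@WInv I).

Fixpoint weval (I : Type) (G : baseGroupType) (f : I -> G) (u : word I) : G :=
  match u with
  | WGen i => f i
  | WOne => 1
  | WMul u1 u2 => weval f u1 * weval f u2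
  | WInv u1 => (weval f u1)^-1
  end.

(* The least congruence on words that contains the group axioms and the
   relations u = v for (u, v) in R. The quotient of [word I] by it is the group
   < I | R >, i.e. the free group on I modulo the normal closure of the
   elements u v^-1; the quotient by [pres_eq [::]] is the free group itself. *)
Inductive pres_eq (I : Type) (R : seq (word I * word I)) :
    word I -> word I -> Prop :=
  | pres_rel u v : List.In (u, v) R -> pres_eq R u v
  | pres_refl u : pres_eq R u u
  | pres_sym u v : pres_eq R u v -> pres_eq R v u
  | pres_trans u v t : pres_eq R u v -> pres_eq R v t -> pres_eq R u t
  | pres_mul u u' v v' :
      pres_eq R u u' -> pres_eq R v v' -> pres_eq R (u * v) (u' * v')
  | pres_inv u u' : pres_eq R u u' -> pres_eq R u^-1 u'^-1
  | pres_mulA u v t : pres_eq R (u * (v * t)) ((u * v) * t)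
  | pres_mul1 u : pres_eq R (1 * u) u
  | pres_mulV u : pres_eq R (u^-1 * u) 1.

(* X = < I | R > with i : I standing for f i: evaluation at f induces an
   isomorphism from the abstract (a priori possibly infinite) group < I | R >
   onto X. *)
Definition has_presentation (gT : finGroupType) (X : {set gT}) (I : Type)
    (f : I -> gT) (R : seq (word I * word I)) : Prop :=
  (forall g : gT, g \in X <-> exists u : word I, weval f u = g) /\
  (forall u v : word I, weval f u = weval f v <-> pres_eq R u v).

Definition exact_product (gT : finGroupType) (X H K : {group gT}) : Prop :=
  H * K = X /\ H :&: K = 1.

Definition dihedral_on (gT : finGroupType) (n : nat) (x y : gT)
    (H : {group gT}) : Prop :=
  [/\ <[x]> ><| <[y]> = H, #[x] = n, #[y] = 2 & x ^ y = x^-1].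

Inductive gen4 : Type := GX | GY | GZ | GW.

Definition assign4 (T : Type) (x y z w : T) (i : gen4) : T :=
  match i with GX => x | GY => y | GZ => z | GW => w end.

Definition dihedral_relations (n m n1 m1 a b c r s t : nat) :
    seq (word gen4 * word gen4) :=
  let x := WGen GX in let y := WGen GY in
  let z := WGen GZ in let w := WGen GW in
  [:: (x ^+ n, 1); (y ^+ 2, 1); (z ^+ m, 1); (w ^+ 2, 1); ([~ x, z], 1);
      (x ^ y, x^-1);
      (z ^ w, z^-1);
      ([~ x, w], x ^+ (s * n1) * z ^+ (b * m1));
      ([~ z, y], x ^+ (r * n1) * z ^+ (a * m1));
      ([~ y, w], x ^+ (t * n1) * z ^+ (c * m1))].

(* Main.v *)
(** X has order 4nm with n, m odd, and the involutions y and w have no common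
    conjugate. Hence w acts on the cosets of H as an odd permutation, and X has
    a subgroup of index 2; repeating this with a regular action yields a normal
    subgroup N of odd order nm. By order, N = <x><z>.

    The key point is that N is abelian. After conjugating w we may assume that
    u = y and v = w commute. If N = AB with A, B cyclic, u inverts A and v
    inverts B, then a ^ v = c d (a, c in A, d in B) forces
    d ^ u = c d^-1 c^-1, because uv = vu. Since automorphism groups of cyclic
    groups are abelian, this shows that an element of N that normalizes a
    suitable cyclic subgroup acts on it as its own inverse, hence trivially.
    Some nontrivial subgroup of A or of B is normalized by N, u and v (if
    |A| <= |B|, look at the intersection of B with a conjugate), and one
    concludes by induction on |N|, in the quotient by this subgroup.

    Now y and w act on the abelian group N = <x> x <z> by commuting
    automorphisms. Splitting [x, w], [z, y] and [y, w] into their components,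
    one finds that w inverts the x-components and y the z-components, so these
    generate normal subgroups of X and lie in the cores. The congruences say
    that these components are inverted. The relations bring every word into
    the form x^i z^j y^e w^f with e, f <= 1, and these words are distinguished
    in X. *)

Require Import Defs.
From HB Require Import structures.
From Stdlib Require Import Setoid Morphisms.
From mathcomp Require Import all_boot all_order all_algebra all_fingroup.
From mathcomp Require Import all_solvable.

Set Implicit Arguments.
Unset Strict Implicit.
Unset Printing Implicit Defensive.

Local Open Scope group_scope.

(** * Products of two inverted cyclic groups *)

(** Every automorphism of a cyclic group is a power map, and power maps commute. *)
Lemma conjg_cyclicC (gT : finGroupType) (M : {group gT}) (g h q : gT) :
  cyclic M -> g \in 'N(M) -> h \in 'N(M) -> q \in M -> (q ^ g) ^ h = (q ^ h) ^ g.
Proof.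
move=> /cyclicP[p defM] nMg nMh Mq.
have Mp : p \in M by rewrite defM cycle_id.
have power k : k \in 'N(M) -> exists i, forall q', q' \in M -> q' ^ k = q' ^+ i.
  move=> nMk; have : p ^ k \in <[p]> by rewrite -defM memJ_norm.
  case/cycleP=> i pk; exists i => q'; rewrite defM => /cycleP[j ->].
  by rewrite conjXg pk -!expgM mulnC.
have [i gi] := power g nMg; have [j hj] := power h nMh.
by rewrite [q ^ g]gi // [q ^ h]hj // !conjXg gi // hj // -!expgM mulnC.
Qed.

(* Conjugation by g and its conjugate by v agree on M, as Aut M is abelian;
   so g acts as its own inverse, and g has odd order. *)
Lemma cent_cyclic_of_inverted (gT : finGroupType) (M : {group gT}) (g v : gT) :
  cyclic M -> g \in 'N(M) -> v \in 'N(M) -> odd #[g] ->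
  {in M, forall q, q ^ (g ^ v) = q ^ g^-1} -> g \in 'C(M).
Proof.
move=> cycM nMg nMv odd_g gvM.
have g_inv q : q \in M -> q ^ g = q ^ g^-1.
  move=> Mq; rewrite -gvM // [g ^ v]conjgE !conjgM.
  by rewrite (conjg_cyclicC cycM nMg nMv) ?memJ_norm ?groupV // conjgKV.
have C2 : g ^+ 2 \in 'C(M).
  apply/centP=> q Mq; apply: commute_sym; apply/commgP/conjg_fixP.
  by rewrite expgS expg1 conjgM g_inv ?memJ_norm // conjgK.
(* An element of odd order is a power of its square, with exponent half of [#[g] + 1]. *)
have [k def_g] : exists k, g = (g ^+ 2) ^+ k.
  exists #[g]./2.+1; rewrite -expgM mul2n doubleS.
  have := odd_double_half #[g]; rewrite odd_g add1n => def_o.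
  by rewrite expgS def_o expg_order mulg1.
by rewrite def_g groupX.
Qed.

(* The situation of the exact product after passing to the normal
   2-complement N, with y and w replaced by commuting conjugates u and v. *)
Record inverted_product (gT : finGroupType) (N A B : {group gT}) (u v : gT) :
    Prop := InvertedProduct {
  ip_mul : A * B = N;
  ip_TI : A :&: B = 1;
  ip_cycA : cyclic A;
  ip_cycB : cyclic B;
  ip_odd : odd #|N|;
  ip_nu : u \in 'N(N);
  ip_nv : v \in 'N(N);
  ip_comm : commute u v;
  ip_u2 : u ^+ 2 = 1;
  ip_v2 : v ^+ 2 = 1;
  ip_invA : {in A, forall a, a ^ u = a^-1};
  ip_invB : {in B, forall b, b ^ v = b^-1}
}.

Lemma inverted_productC (gT : finGroupType) (N A B : {group gT}) (u v : gT) :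
  inverted_product N A B u v -> inverted_product N B A v u.
Proof.
case=> defN tiAB cA cB oN nu nv cuv u2 v2 uA vB.
by split=> //; [rewrite -(comm_group_setP _) defN ?groupP | rewrite setIC].
Qed.

Section InvertedProduct.

Variables (gT : finGroupType) (N A B : {group gT}) (u v : gT).
Hypothesis ipN : inverted_product N A B u v.

Lemma ip_subA : A \subset N. Proof. by rewrite -(ip_mul ipN) mulG_subl. Qed.
Lemma ip_subB : B \subset N. Proof. by rewrite -(ip_mul ipN) mulG_subr. Qed.

Lemma ip_odd_order g : g \in N -> odd #[g].
Proof. by move=> Ng; apply: dvdn_odd (ip_odd ipN); rewrite order_dvdG. Qed.

(** Since [u] commutes with [v] and inverts [a], it inverts [a ^ v = c * d]; it also inverts [c],
    and solving for [d ^ u] gives the formula. *)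
Lemma ip_swap a c d :
  a \in A -> c \in A -> d \in B -> a ^ v = c * d -> d ^ u = c * d^-1 * c^-1.
Proof.
move=> Aa Ac Bd av; have : (a ^ v) ^ u = (a ^ u) ^ v.
  by rewrite -!conjgM (ip_comm ipN).
rewrite (ip_invA ipN Aa) conjVg av conjMg (ip_invA ipN Ac) => /(canRL (mulKg _)) ->.
by rewrite invMg invgK mulgA.
Qed.

(** Conjugation by [v] turns each [b] in [B] into [b^-1], so [cent_cyclic_of_inverted] applies. *)
Lemma ip_cent (M : {group gT}) :
  M \subset A -> B \subset 'N(M) -> v \in 'N(M) -> B \subset 'C(M).
Proof.
move=> sMA nMB nMv; apply/subsetP=> b Bb.
apply: (cent_cyclic_of_inverted (cyclicS sMA (ip_cycA ipN)) _ nMv) => //.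
- exact: (subsetP nMB).
- by rewrite ip_odd_order // (subsetP ip_subB).
by move=> q Mq; rewrite (ip_invB ipN).
Qed.

Lemma ip_norm_inverted (M : {group gT}) : M \subset A -> u \in 'N(M).
Proof.
move=> sMA; apply/normP/eqP; rewrite eqEcard cardJg leqnn andbT.
apply/subsetP=> _ /imsetP[q Mq ->].
by rewrite (ip_invA ipN) ?groupV // (subsetP sMA).
Qed.

Lemma ip_quotient (M : {group gT}) :
  M \subset A -> N \subset 'N(M) -> v \in 'N(M) ->
  inverted_product (N / M) (A / M) (B / M) (coset M u) (coset M v).
Proof.
move=> sMA nMN nMv; have nMu := ip_norm_inverted sMA.
have nMA := subset_trans ip_subA nMN; have nMB := subset_trans ip_subB nMN.
have [defN tiAB cA cB oN nu nv cuv u2 v2 uA vB] := ipN.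
split; rewrite ?quotient_cyclic ?quotient_odd //.
- by rewrite -quotientMl ?defN.
- by rewrite -quotientGI // tiAB quotient1.
- by rewrite inE -quotientJ // (normP nu).
- by rewrite inE -quotientJ // (normP nv).
- by rewrite /commute -!morphM // cuv.
- by rewrite -morphX // u2 morph1.
- by rewrite -morphX // v2 morph1.
- by move=> _ /morphimP[a nMa Aa ->]; rewrite -morphJ // uA // morphV.
by move=> _ /morphimP[b nMb Bb ->]; rewrite -morphJ // vB // morphV.
Qed.

End InvertedProduct.

(** With [A = <[x]>], the candidate is [B1 = B :&: B :^ x], normalized by [N] and [v]. If [u] moves
    [B1] out of [B], the [A]-component of some [q ^ u] generates a suitable subgroup instead. *)
Lemma ip_exists_normal_le (gT : finGroupType) (N A B : {group gT}) (u v : gT) :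
  inverted_product N A B u v -> N :!=: 1 -> #|A| <= #|B| ->
  exists M : {group gT},
    [/\ M :!=: 1, (M \subset A) || (M \subset B), N \subset 'N(M),
        u \in 'N(M) & v \in 'N(M)].
Proof.
move=> ipN ntN leAB.
have cAA := cyclic_abelian (ip_cycA ipN).
have cBB := cyclic_abelian (ip_cycB ipN).
have [x defA] := cyclicP (ip_cycA ipN).
have Ax : x \in A by rewrite defA cycle_id.
pose B1 := (B :&: B :^ x)%G.
have sB1B : B1 \subset B by apply: subsetIl.
have ntB1 : B1 :!=: 1.
  (* If [B1] were trivial, [B * B :^ x] would have [#|B| * #|B| >= #|N|] elements and fill [N]. This
     puts [x] in [B], which collapses [N]. *)
  apply/eqP=> /= tiBx; have defN : B * B :^ x = N.
    apply/eqP; rewrite eqEcard mul_subG ?(ip_subB ipN) //=; last first.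
      by rewrite -(conjGid (subsetP (ip_subA ipN) x Ax)) conjSg (ip_subB ipN).
    rewrite (TI_cardMg tiBx) cardJg -(ip_mul ipN) (TI_cardMg (ip_TI ipN)).
    by rewrite leq_mul2r leAB orbT.
  have : x \in B * B :^ x by rewrite defN (subsetP (ip_subA ipN)).
  case/mulsgP=> b1 _ Bb1 /imsetP[b2 Bb2 ->] def_x.
  have Bx : x \in B.
    suff -> : x = b2 * b1 by rewrite groupM.
    have : 1 = b1 * x^-1 * b2.
      by apply: (mulIg x); rewrite mul1g {1}def_x conjgE !mulgA.
    by move/eqP; rewrite eq_sym -eq_invg_mul => /eqP <-; rewrite invMg invgK mulgKV.
  have B_1 : B :=: 1 by rewrite -tiBx /= conjGid // setIid.
  have sAB : A \subset B by rewrite defA cycle_subG.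
  by case/eqP: ntN; rewrite -(ip_mul ipN) (mulSGid sAB).
have nxB1 : x \in 'N(B1).
  rewrite -groupV inE -{2}(conjsgK x B1) conjSg.
  (* Both sides have the same order inside the cyclic group [B :^ x]. *)
  have eqB1 : B1 :^ x :=: B1.
    apply/eqP; rewrite (eq_subG_cyclic (G := (B :^ x)%G)) ?cyclicJ ?cardJg ?conjSg //.
      exact: ip_cycB ipN.
    exact: subsetIr.
  by rewrite eqB1.
have nNB1 : N \subset 'N(B1).
  rewrite -(ip_mul ipN) mul_subG //; first by rewrite defA cycle_subG.
  by rewrite cents_norm // (subset_trans cBB) // centS.
have nvB1 : v \in 'N(B1) by apply: (ip_norm_inverted (inverted_productC ipN)).
(* For [b ^ u = d * c], [ip_swap] gives [c ^ v = d * c^-1 * d^-1]. As [d] centralizes [B1], [c ^ v]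
   acts on [B1] as [c^-1], so [c] centralizes [B1] too. *)
have cB1 b : b \in B -> b ^ u \in 'C(B1).
  move=> Bb; have : b ^ u \in B * A.
    rewrite (ip_mul (inverted_productC ipN)) memJ_norm ?(ip_nu ipN) //.
    exact: (subsetP (ip_subB ipN)).
  case/mulsgP=> d c Bd Ac bu; rewrite bu.
  have cv := ip_swap (inverted_productC ipN) Bb Bd Ac bu.
  have cB1d : d \in 'C(B1) by apply: subsetP Bd; rewrite (subset_trans cBB) // centS.
  have Nc : c \in N by apply: subsetP Ac; apply: ip_subA ipN.
  rewrite groupM //.
  apply: (cent_cyclic_of_inverted (cyclicS sB1B (ip_cycB ipN)) _ nvB1).
  - exact: (subsetP nNB1).
  - exact: (ip_odd_order ipN).
  move=> q B1q; rewrite cv !conjgM [q ^ d]conjgE -(centP cB1d q) // mulKg.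
  rewrite [_ ^ d^-1]conjgE -(centP (groupVr cB1d)) ?mulKg //.
  by rewrite memJ_norm // groupV (subsetP nNB1).
have [sB1uB | ] := boolP (B1 :^ u \subset B).
  exists B1; rewrite sB1B orbT; split=> //; apply/normP/eqP.
  by rewrite (eq_subG_cyclic (ip_cycB ipN)) ?cardJg.
case/subsetPn=> _ /imsetP[q B1q ->] B'qu.
have : q ^ u \in B * A.
  rewrite (ip_mul (inverted_productC ipN)) memJ_norm ?(ip_nu ipN) //.
  by rewrite (subsetP (ip_subB ipN)) // (subsetP sB1B).
case/mulsgP=> d c Bd Ac qu.
(* [B :^ u] centralizes [B1], so [B] centralizes [B1 :^ u] because [u ^+ 2 = 1]; hence [q ^ u] and
   [d] both commute with [B]. *)
have cBc : c \in 'C(B).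
  have -> : c = d^-1 * q ^ u by rewrite qu mulKg.
  rewrite groupM ?groupV ?(subsetP cBB d) //; apply/centP=> b Bb.
  have uu : u * u = 1 by apply: ip_u2 ipN.
  apply: (conjg_inj u); rewrite conjMg [RHS]conjMg -conjgM uu conjg1.
  exact/esym/(centP (cB1 b Bb)).
have cv : c ^ v = c^-1.
  rewrite (ip_swap (inverted_productC ipN) (subsetP sB1B q B1q) Bd Ac qu).
  by rewrite -(centP (groupVr cBc) d Bd) mulgK.
have ntc : c != 1.
  by apply: contraNneq B'qu => c1; rewrite qu c1 mulg1.
exists <[c]>%G; rewrite cycle_eq1 ntc cycle_subG Ac; split=> //.
- rewrite -(ip_mul ipN) mul_subG ?cents_norm //.
    by rewrite (subset_trans cAA) // centS // cycle_subG.
  by rewrite centsC cycle_subG.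
- by rewrite (ip_norm_inverted ipN) // cycle_subG.
by rewrite -cycle_subG norms_cycle cv groupV cycle_id.
Qed.

Lemma ip_exists_normal (gT : finGroupType) (N A B : {group gT}) (u v : gT) :
  inverted_product N A B u v -> N :!=: 1 ->
  exists M : {group gT},
    [/\ M :!=: 1, (M \subset A) || (M \subset B), N \subset 'N(M),
        u \in 'N(M) & v \in 'N(M)].
Proof.
move=> ipN ntN; have [/(ip_exists_normal_le ipN)|/ltnW leBA] := leqP #|A| #|B|.
  exact.
have [M []] := ip_exists_normal_le (inverted_productC ipN) ntN leBA.
by rewrite orbC => ? ? ? ? ?; exists M.
Qed.

(** Induction modulo an invariant subgroup [M] of [A] puts [[~: A, B]] inside [A]. If [v] does not
    normalize [A], an invariant subgroup [<[d]>] of [B] also arises, so that [[~: A, B]] lies in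
    [A :&: B = 1]. *)
Theorem inverted_product_cents (gT : finGroupType) (N A B : {group gT})
    (u v : gT) :
  inverted_product N A B u v -> B \subset 'C(A).
Proof.
have [k] := ubnP #|N|; elim: k => // k IHk in gT N A B u v *.
rewrite ltnS => leNk ipN; have [N1 | ntN] := eqVneq (N : {set gT}) 1.
  by have := ip_subB ipN; rewrite N1 => /trivgP ->; rewrite sub1G.
(* The factors are kept arbitrary because the step is used for [A, B] and again with the two
   exchanged. *)
have IHM (A1 B1 M : {group gT}) (u1 v1 : gT) : inverted_product N A1 B1 u1 v1 ->
    M :!=: 1 -> M \subset A1 -> N \subset 'N(M) -> v1 \in 'N(M) ->
    [~: A1, B1] \subset M.
  move=> ipN1 ntM sMA nMN nMv.
  have nMA := subset_trans (ip_subA ipN1) nMN.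
  have nMB := subset_trans (ip_subB ipN1) nMN.
  rewrite -quotient_cents2 // centsC.
  apply: (IHk _ _ _ _ _ _ _ (ip_quotient ipN1 sMA nMN nMv)).
  apply: leq_trans leNk; apply: ltn_quotient => //.
  exact: subset_trans (ip_subA ipN1).
have [M [ntM sM nMN nMu nMv]] := ip_exists_normal ipN ntN.
wlog sMA : A B u v ipN sM nMu nMv / M \subset A.
  move=> wl; case/orP: (sM) => [sMA|sMB]; first exact: (wl A B u v).
  rewrite centsC; apply: (wl B A v u) => //; last by rewrite orbC.
  exact: inverted_productC.
have sABM := IHM _ _ _ _ _ ipN ntM sMA nMN nMv.
have nAB : B \subset 'N(A).
  by rewrite -commg_subl (subset_trans sABM).
have [nAv | ] := boolP (v \in 'N(A)).
  exact: (ip_cent ipN (fintype.subxx A) nAB nAv).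
rewrite inE => /subsetPn[_ /imsetP[a Aa ->] A'av].
have : a ^ v \in A * B.
  by rewrite (ip_mul ipN) memJ_norm ?(ip_nv ipN) // (subsetP (ip_subA ipN)).
case/mulsgP=> c d Ac Bd av; have du := ip_swap ipN Aa Ac Bd av.
(* [d ^ u = c * d^-1 * c^-1] acts on the abelian group [A] as [d^-1]. *)
have cAd : d \in 'C(A).
  apply: (cent_cyclic_of_inverted (ip_cycA ipN) _ (ip_norm_inverted ipN _)) => //.
  - exact: (subsetP nAB).
  - by rewrite (ip_odd_order ipN) // (subsetP (ip_subB ipN)).
  have cAA := cyclic_abelian (ip_cycA ipN).
  move=> q Aq; rewrite du !conjgM [q ^ c]conjgE (centsP cAA q _ c) // mulKg.
  rewrite [_ ^ c^-1]conjgE (centsP cAA _ _ c^-1) ?groupV ?mulKg //.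
  by rewrite memJ_norm // groupV (subsetP nAB).
have {}du : d ^ u = d^-1.
  by rewrite du -(centP (groupVr cAd) c Ac) mulgK.
have ntd : d != 1.
  by apply: contraNneq A'av => d1; rewrite av d1 mulg1.
have nNd : N \subset 'N(<[d]>).
  rewrite -(ip_mul ipN) mul_subG // ?cycle_subG //.
    by rewrite (subset_trans _ (cent_sub _)) // centsC cycle_subG.
  have cBB := cyclic_abelian (ip_cycB ipN).
  by rewrite cents_norm // (subset_trans cBB) // centS // cycle_subG.
have nud : u \in 'N(<[d]>) by rewrite -cycle_subG norms_cycle du groupV cycle_id.
have sdB : <[d]> \subset B by rewrite cycle_subG.
have ntcd : <[d]> :!=: 1 by rewrite cycle_eq1.
have := IHM _ _ _ _ _ (inverted_productC ipN) ntcd sdB nNd nud.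
rewrite commGC => sABd; rewrite centsC; apply/commG1P/trivgP.
by rewrite -(ip_TI ipN) subsetI (subset_trans sABM) // (subset_trans sABd).
Qed.

(** * The normal 2-complement *)

(** Splitting off the transposition of [i] and [s i] leaves an involution that moves two points
    fewer. *)
Lemma odd_perm_involution (T : finType) (s : {perm T}) (k : nat) :
  involutive s -> #|[pred i | s i != i]| = k.*2 -> odd_perm s = odd k.
Proof.
elim: k s => [|k IHk] s sK card_s.
  suff -> : s = 1 by rewrite odd_perm1.
  apply/permP=> i; rewrite perm1; apply/eqP.
  by have /card0_eq/(_ i) := card_s; rewrite inE => /negbFE.
have [i si] : exists i, s i != i.
  have /card_gt0P[i si] : 0 < #|[pred i | s i != i]| by rewrite card_s.
  by exists i.
pose s' := tperm i (s i) * s.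
have s'E j : s' j = if (j == i) || (j == s i) then j else s j.
  by rewrite permM; case: tpermP => [-> | -> | /eqP/negPf-> /eqP/negPf->];
     rewrite ?eqxx ?orbT.
have s'K : involutive s'.
  move=> j; have := s'E j; case: ifPn => [j_is | /negPf j_is] ->; rewrite s'E.
    by rewrite j_is.
  by rewrite (can2_eq sK sK) (inj_eq perm_inj) orbC j_is sK.
have -> : s = tperm i (s i) * s' by rewrite mulgA tperm2 mul1g.
rewrite odd_mul_tperm eq_sym si (IHk s') //.
pose D := [pred j | s j != j]; have Di : i \in D by [].
have D'si : s i \in [predD1 D & i].
  by apply/andP; split=> //; rewrite -[_ \in _]/(s (s i) != s i) sK eq_sym.
move: card_s; rewrite (cardD1 i) Di (cardD1 (s i)) D'si.
rewrite doubleS => -[<-]; apply: eq_card => j; rewrite !inE s'E.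
by case: (j =P s i) => [->|_]; rewrite ?orbT ?eqxx ?andbF //;
   case: (j =P i) => [->|_]; rewrite ?eqxx.
Qed.

(** [M] is the kernel of [f], a homomorphism to the booleans under [(+)]; its complement in [G] is
    the coset of [t]. Odd powers of an element outside the kernel stay outside, so they are not
    1. *)
Lemma index2_of_sign (gT : finGroupType) (G : {group gT}) (f : gT -> bool)
    (t : gT) :
  {in G &, forall g h, f (g * h) = f g (+) f h} -> t \in G -> f t ->
  exists M : {group gT},
    [/\ M \subset G, #|G| = #|M|.*2 & {in G, forall g, odd #[g] -> g \in M}].
Proof.
move=> fM Gt ft; have f1 : f 1 = false.
  by have := fM 1 1 (group1 G) (group1 G); rewrite mulg1 addbb.
have gM : group_set [set g in G | ~~ f g].
  apply/group_setP; split=> [|g h]; rewrite !inE ?group1 ?f1 //.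
  by case/andP=> Gg /negPf fg /andP[Gh /negPf fh]; rewrite groupM // fM // fg fh.
pose M := Group gM; have sMG : M \subset G by apply/subsetP=> g; rewrite inE => /andP[].
exists M; split=> //.
  rewrite -addnn -(cardsID M G) (setIidPr sMG); congr (_ + _)%N.
  rewrite -(card_rcoset M t); apply: eq_card => g.
  rewrite mem_rcoset !inE groupMr ?groupV //.
  case Gg: (g \in G); rewrite ?andbF //= andbT negbK.
  by have := fM (g * t^-1) t; rewrite mulgKV groupM ?groupV // ft addbT => ->.
move=> g Gg odd_g; rewrite inE Gg; apply/negP=> fg.
suff : f (g ^+ #[g]) by rewrite expg_order f1.
have fX i : f (g ^+ i) = odd i.
  by elim: i => // i IHi; rewrite expgS fM ?groupX // fg IHi.
by rewrite fX.
Qed.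

(** As no conjugate of [t] lies in [L], [t] fixes no coset of [L]; it moves all [k.*2] of them by
    [k] transpositions, an odd permutation. *)
Lemma index2_of_free_involution (gT : finGroupType) (G L : {group gT}) (t : gT)
    (k : nat) :
  L \subset G -> #|G : L| = k.*2 -> odd k -> t \in G -> t ^+ 2 = 1 ->
  {in G, forall g, t ^ g \notin L} ->
  exists M : {group gT},
    [/\ M \subset G, #|G| = #|M|.*2 & {in G, forall g, odd #[g] -> g \in M}].
Proof.
move=> sLG iGL odd_k Gt t2 freet.
have nG : [acts G, on rcosets L G | 'Rs] := actsRs_rcosets L G.
(* [rho g] permutes all sets but is the identity off the cosets, so only cosets count as moved
   points. *)
pose rho := actperm <[nG]>.
apply: (@index2_of_sign _ G (fun g => odd_perm (rho g)) t) => //=.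
  by move=> g h Gg Gh; rewrite -odd_permM /rho actpermM.
have rhoE g C : g \in G -> C \in rcosets L G -> rho g C = C :* g.
  by move=> Gg LC; rewrite actpermE actbyE //= rcosetE.
have := @odd_perm_involution _ (rho t) k; rewrite odd_k => -> //.
  move=> C; rewrite -permM -actpermM // -[t * t]/(t ^+ 2) t2.
  by rewrite /rho morph1 perm1.
rewrite -iGL; apply: eq_card => C; rewrite inE.
have [LC | L'C] := boolP (C \in rcosets L G); last first.
  by rewrite actpermE /= /actby (negPf L'C) eqxx.
rewrite rhoE //; case/rcosetsP: LC => g Gg ->.
apply: contra (freet _ (groupVr Gg)) => /eqP def_g.
have : g * t \in L :* g by rewrite -def_g -rcosetM mem_rcoset mulgV group1.
by rewrite mem_rcoset conjgE invgK mulgA.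
Qed.

(** With [g = k * h] in [K * H], conjugation by [h] preserves [H], so [q ^ k] lies in [H :&: K]. *)
Lemma exact_product_conj (gT : finGroupType) (X H K : {group gT}) (q g : gT) :
  exact_product X H K -> q \in K -> g \in X -> q ^ g \in H -> q = 1.
Proof.
case=> defX tiHK Kq.
have <- : K * H = X by rewrite -(comm_group_setP _) ?defX ?groupP.
case/mulsgP=> k h Kk Hh ->; rewrite conjgM groupJr // => Hqk.
have : q ^ k \in H :&: K by rewrite inE Hqk groupJ.
by rewrite tiHK => /set1P/eqP; rewrite conjg_eq1 => /eqP.
Qed.

Lemma odd_normal_complement (gT : finGroupType) (X H K : {group gT}) (w : gT)
    (n m : nat) :
  exact_product X H K -> #|H| = n.*2 -> #|K| = m.*2 -> odd n -> odd m ->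
  w \in K -> #[w] = 2 ->
  exists N : {group gT},
    [/\ N <| X, #|N| = (n * m)%N & {in X, forall g, odd #[g] -> g \in N}].
Proof.
move=> XHK cH cK on om Kw ow; have [defX tiHK] := XHK.
have sHX : H \subset X by rewrite -defX mulG_subl.
have sKX : K \subset X by rewrite -defX mulG_subr.
have cX : #|X| = (n.*2 * m.*2)%N by rewrite -defX TI_cardMg // cH cK.
have iXH : #|X : H| = m.*2.
  by rewrite -divgS // cX cH mulKn // double_gt0 odd_gt0.
have w2 : w ^+ 2 = 1 by rewrite -ow expg_order.
have [M [sMX cM oM]] : exists M : {group gT},
    [/\ M \subset X, #|X| = #|M|.*2 & {in X, forall g, odd #[g] -> g \in M}].
  apply: (index2_of_free_involution sHX iXH om (subsetP sKX w Kw) w2) => g Xg.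
  apply/negP=> /(exact_product_conj XHK Kw Xg) w1.
  by move: ow; rewrite w1 order1.
have {}cM : #|M| = (n * m).*2.
  by apply: double_inj; rewrite -cM cX -doubleMl -doubleMr.
have [t Mt ot] : exists2 t, t \in M & #[t] = 2.
  by have [|t] := @Cauchy _ 2 M isT; rewrite ?cM ?dvdn2 ?odd_double //; exists t.
have t2 : t ^+ 2 = 1 by rewrite -ot expg_order.
have iM1 : #|M : 1| = (n * m).*2 by rewrite indexg1.
have onm : odd (n * m) by rewrite oddM on om.
(* The regular action of [M] is its action on the cosets of the trivial subgroup, and no conjugate
   of [t] is 1. *)
have [N [sNM cN oMN]] : exists N : {group gT},
    [/\ N \subset M, #|M| = #|N|.*2 & {in M, forall g, odd #[g] -> g \in N}].
  apply: (index2_of_free_involution (sub1G M) iM1 onm Mt t2) => g Mg.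
  apply/negP=> /set1P/eqP; rewrite conjg_eq1 => /eqP t1.
  by move: ot; rewrite t1 order1.
have {}cN : #|N| = (n * m)%N by apply: double_inj; rewrite -cN cM.
have oN g : g \in X -> odd #[g] -> g \in N by move=> Xg og; rewrite oMN ?oM.
exists N; split=> //; have sNX := subset_trans sNM sMX.
(* [N] consists exactly of the elements of odd order in [X], hence is stable under conjugation. *)
apply/andP; split=> //; apply/subsetP=> h Xh; rewrite inE.
apply/subsetP=> _ /imsetP[g Ng ->].
apply: oN; first by rewrite groupJ // (subsetP sNX).
by rewrite orderJ; apply: dvdn_odd onm; rewrite -cN order_dvdG.
Qed.

Lemma exact_product_dihedral (gT : finGroupType) (n m : nat)
    (X H K : {group gT}) (x y z w : gT) :
  odd n -> odd m -> exact_product X H K ->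
  dihedral_on n x y H -> dihedral_on m z w K ->
  exists N : {group gT},
    [/\ N <| X, odd #|N|, <[x]> * <[z]> = N, commute x z & [~ y, w] \in N].
Proof.
move=> on om XHK [defH ox oy xy] [defK oz ow zw]; have [defX tiHK] := XHK.
have cH : #|H| = n.*2 by rewrite -(sdprod_card defH) -!orderE ox oy muln2.
have cK : #|K| = m.*2 by rewrite -(sdprod_card defK) -!orderE oz ow muln2.
have [_ defxy nxy tixy] := sdprodP defH; have [_ defzw nzw tizw] := sdprodP defK.
have Hx : x \in H by rewrite -cycle_subG -defxy mulG_subl.
have Hy : y \in H by rewrite -cycle_subG -defxy mulG_subr.
have Kz : z \in K by rewrite -cycle_subG -defzw mulG_subl.
have Kw : w \in K by rewrite -cycle_subG -defzw mulG_subr.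
have sHX : H \subset X by rewrite -defX mulG_subl.
have sKX : K \subset X by rewrite -defX mulG_subr.
have Xx := subsetP sHX x Hx; have Xy := subsetP sHX y Hy.
have Xz := subsetP sKX z Kz; have Xw := subsetP sKX w Kw.
have [N [nNX cN oN]] := odd_normal_complement XHK cH cK on om Kw ow.
have oddN : odd #|N| by rewrite cN oddM on om.
have Nx : x \in N by rewrite oN ?ox.
have Nz : z \in N by rewrite oN ?oz.
have [sNX nNX'] := andP nNX.
have sxH : <[x]> \subset H by rewrite cycle_subG.
have szK : <[z]> \subset K by rewrite cycle_subG.
have cX : #|X| = (2 ^ 2 * (n * m))%N.
  by rewrite -defX TI_cardMg // cH cK -!mul2n mulnACA.
have cXN : [~ y, w] \in N.
  have abXN : abelian (X / N).
    apply: (@card_p2group_abelian _ 2) => //.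
    by rewrite card_quotient // -divgS // cX cN mulnK // -cN.
  apply: (subsetP (_ : [~: X, X] \subset N)); last exact: mem_commg.
  by rewrite -quotient_cents2.
(* A Sylow 2-subgroup has order 4 and so is abelian; one of them contains [y] and a conjugate
   [w ^ g], which therefore commute. *)
have [P sylP syP] : {P : {group gT} | 2.-Sylow(X) P & <[y]> \subset P}.
  by apply: Sylow_superset; rewrite ?cycle_subG // /pgroup -orderE oy.
have [g Xg swP] : exists2 g, g \in X & <[w]> :^ g \subset P.
  by apply: (Sylow_Jsub sylP); rewrite ?cycle_subG // /pgroup -orderE ow.
have abP : abelian P.
  apply: (@p2group_abelian _ 2); first exact: pHall_pgroup sylP.
  rewrite (card_Hall sylP) logn_part cX lognM ?(@odd_gt0 (n * m)) ?oddM ?on //.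
  by rewrite pfactorK // logn_coprime // coprime2n oddM on om.
have cyw : commute y (w ^ g).
  apply: (centsP abP); first by rewrite -cycle_subG.
  by rewrite -cycle_subG cycleJ.
pose B := <[z ^ g]>%G.
have tixB : <[x]> :&: B = 1.
  apply/trivgP/subsetP=> q /setIP[/(subsetP sxH) Hq /cycleP[i def_q]].
  rewrite def_q -conjXg in Hq; rewrite def_q -conjXg inE.
  by rewrite (exact_product_conj XHK (groupX i Kz) Xg Hq) conj1g.
have defxB : <[x]> * B = N.
  apply/eqP; rewrite eqEcard mul_subG ?cycle_subG //=; last first.
    by rewrite memJ_norm // (subsetP nNX').
  by rewrite (TI_cardMg tixB) -!orderE orderJ ox oz cN.
have ipN : inverted_product N <[x]> B y (w ^ g).
  split; rewrite ?cycle_cyclic //.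
  - exact: (subsetP nNX').
  - by rewrite (subsetP nNX') // groupJ.
  - by rewrite -oy expg_order.
  - by rewrite -conjXg -ow expg_order conj1g.
  - by move=> _ /cycleP[i ->]; rewrite conjXg xy expgVn.
  by move=> _ /cycleP[i ->]; rewrite conjXg -conjJg zw conjVg expgVn.
have sBC := inverted_product_cents ipN.
(* To return from [z ^ g] to [z], write [g = k * h]: [k] normalizes [<[z]>] and [h] normalizes
   [<[x]>], so conjugating back by [h] suffices. *)
have cxz : commute x z.
  have nxH : H \subset 'N(<[x]>) by rewrite -defxy mul_subG ?normG.
  have nzK : K \subset 'N(<[z]>) by rewrite -defzw mul_subG ?normG.
  have defKH : K * H = X by rewrite -(comm_group_setP _) defX ?groupP.
  have : g \in K * H by rewrite defKH.
  case/mulsgP=> k h Kk Hh def_g.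
  have : <[z]> \subset 'C(<[x]>).
    rewrite -(conjSg _ _ h) -centJ (normP (subsetP nxH h Hh)).
    by rewrite -(normP (subsetP nzK k Kk)) -conjsgM -def_g -cycleJ.
  by rewrite cycle_subG => /centP/(_ x (cycle_id x)).
exists N; split=> //.
apply/eqP; rewrite eqEcard mul_subG ?cycle_subG //=.
rewrite TI_cardMg -?orderE ?ox ?oz ?cN //; apply/trivgP.
by rewrite -tiHK setISS.
Qed.

(** * Cores and congruences *)

(** These data are symmetric under exchanging [x, y] with [z, w] ([dihedral_frameC]), so each result
    on [<[x]>] also serves for [<[z]>]. *)
Record dihedral_frame (gT : finGroupType) (X N : {group gT}) (x y z w : gT) :
    Prop := DihedralFrame {
  df_gen : <<[set x; y; z; w]>> = X;
  df_mul : <[x]> * <[z]> = N;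
  df_TI : <[x]> :&: <[z]> = 1;
  df_xz : commute x z;
  df_nN : X \subset 'N(N);
  df_yw : [~ y, w] \in N;
  df_y2 : y ^+ 2 = 1;
  df_w2 : w ^+ 2 = 1;
  df_xy : x ^ y = x^-1;
  df_zw : z ^ w = z^-1
}.

Lemma dihedral_frameC (gT : finGroupType) (X N : {group gT}) (x y z w : gT) :
  dihedral_frame X N x y z w -> dihedral_frame X N z w x y.
Proof.
case=> gX defN tixz cxz nN yw y2 w2 xy zw; split=> //.
- rewrite -gX; congr <<_>>; apply/setP=> q; rewrite !inE.
  by case: (q == x); case: (q == y); case: (q == z); case: (q == w).
- by rewrite -(comm_group_setP _) defN ?groupP.
- by rewrite setIC.
by rewrite -invg_comm groupV.
Qed.

Section Frame.

Variables (gT : finGroupType) (X N : {group gT}) (x y z w : gT).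
Hypothesis dfX : dihedral_frame X N x y z w.

Lemma df_mem q : q \in [set x; y; z; w] -> q \in X.
Proof. by move=> Sq; rewrite -(df_gen dfX) mem_gen. Qed.

Lemma df_norm (M : {group gT}) :
  x \in 'N(M) -> y \in 'N(M) -> z \in 'N(M) -> w \in 'N(M) -> X \subset 'N(M).
Proof.
move=> nx ny nz nw; rewrite -(df_gen dfX) gen_subG.
by rewrite !subUset !sub1set nx ny nz nw.
Qed.

Lemma df_cent p q : p \in <[x]> -> q \in <[z]> -> commute p q.
Proof.
by move=> /cycleP[i ->] /cycleP[j ->]; apply/commuteX2/(df_xz dfX).
Qed.

Lemma df_abelian : abelian N.
Proof.
rewrite -(df_mul dfX) abelianM !cycle_abelian /=.
by apply/centsP=> q zq p xp; apply/esym/df_cent.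
Qed.

Lemma df_subx : <[x]> \subset N. Proof. by rewrite -(df_mul dfX) mulG_subl. Qed.
Lemma df_subz : <[z]> \subset N. Proof. by rewrite -(df_mul dfX) mulG_subr. Qed.

Lemma df_invx p : p \in <[x]> -> p ^ y = p^-1.
Proof. by case/cycleP=> i ->; rewrite conjXg (df_xy dfX) expgVn. Qed.

Lemma df_invz q : q \in <[z]> -> q ^ w = q^-1.
Proof. by case/cycleP=> i ->; rewrite conjXg (df_zw dfX) expgVn. Qed.

Lemma df_normN g q : g \in [set x; y; z; w] -> q \in N -> q ^ g \in N.
Proof.
by move=> /df_mem Xg Nq; rewrite memJ_norm // (subsetP (df_nN dfX)).
Qed.

(** The two actions differ by that of [[~ y, w]], which lies in the abelian group [N]. *)
Lemma df_conj_comm q : q \in N -> (q ^ y) ^ w = (q ^ w) ^ y.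
Proof.
move=> Nq; rewrite -!conjgM (commgC y w) [LHS]conjgM [LHS]conjgE.
rewrite (centsP df_abelian _ _ [~ y, w]) ?(df_yw dfX) ?mulKg // conjgM.
by rewrite !df_normN // !inE eqxx ?orbT.
Qed.

Lemma df_uniq p q p' q' :
  p \in <[x]> -> q \in <[z]> -> p' \in <[x]> -> q' \in <[z]> ->
  p * q = p' * q' -> p = p' /\ q = q'.
Proof.
move=> xp zq xp' zq' eq_pq.
have eq1 : p'^-1 * p = q' * q^-1.
  by apply: (mulgI p'); rewrite mulKVg mulgA -eq_pq mulgK.
have : p'^-1 * p \in <[x]> :&: <[z]>.
  by rewrite inE {2}eq1 !groupM ?groupV.
rewrite (df_TI dfX) => /set1P p1; move: eq1; rewrite p1.
split; first by apply: (mulgI p'^-1); rewrite p1 mulVg.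
by apply: (mulIg q^-1); rewrite -eq1 mulgV.
Qed.

(** [<[p]>] is centralized by [x] and [z] and inverted by [y], so only [w] can fail to normalize it.
    Conversely, for [p] in the core, [p ^ w] lies in the cyclic group [<[x]>] and has the order of
    [p]. *)
Lemma df_gcoreP p :
  reflect (p ^ w \in <[p]> /\ p \in <[x]>) (p \in gcore <[x]> X).
Proof.
apply: (iffP idP) => [Cp | [pw xp]].
  have xp := subsetP (gcore_sub _ _) p Cp; split=> //.
  have Cpw : p ^ w \in gcore <[x]> X.
    by rewrite memJ_norm // (subsetP (gcore_norm _ _)) // df_mem // !inE eqxx ?orbT.
  have spx : <[p]> \subset <[x]> by rewrite cycle_subG.
  have spwx : <[p ^ w]> \subset <[x]>.
    by rewrite cycle_subG (subsetP (gcore_sub _ _) _ Cpw).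
  rewrite -cycle_subG; apply/eqP/eqP.
  have /eqP -> : <[p ^ w]> == <[p]> :> {set gT}.
    by rewrite (eq_subG_cyclic (cycle_cyclic x)) // -!orderE orderJ.
  exact: subxx.
have nM g : p ^ g \in <[p]> -> g \in 'N(<[p]>).
  by move=> pg; rewrite -cycle_subG norms_cycle.
apply: subsetP (cycle_id p); apply: gcore_max; first by rewrite cycle_subG.
apply: df_norm; apply: nM => //.
- by rewrite conjgE (centsP (cycle_abelian x) p _ x) ?mulKg ?cycle_id.
- by rewrite df_invx // groupV cycle_id.
by rewrite conjgE (df_cent xp (cycle_id z)) mulKg cycle_id.
Qed.

Lemma df_gcore_inv p : p \in <[x]> -> p ^ w = p^-1 -> p \in gcore <[x]> X.
Proof. by move=> xp pw; apply/df_gcoreP; rewrite pw groupV cycle_id. Qed.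

(** The first equation comes from [(x ^ y) ^ w = (x ^ w) ^ y], the second from [(x ^ w) ^ w = x]. *)
Lemma df_xw p q :
  p \in <[x]> -> q \in <[z]> -> [~ x, w] = p * q -> q ^ y = q^-1 /\ p ^ w = p^-1.
Proof.
move=> xp zq xwE; have xx := cycle_id x; pose a := x * p.
have xa : a \in <[x]> by rewrite groupM.
have xw : x ^ w = a * q by rewrite -mulgA -xwE conjg_mulR.
split.
  have := df_conj_comm (subsetP df_subx x xx).
  rewrite (df_xy dfX) conjVg xw conjMg (df_invx xa) (df_cent xa zq) invMg.
  by move/mulgI.
have : x = (x ^ w) ^ w by rewrite -conjgM -[w * w]/(w ^+ 2) (df_w2 dfX) conjg1.
rewrite xw conjMg (df_invz zq) => /(canLR (mulgKV _)) /= aw.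
have -> : p = x^-1 * a by rewrite mulKg.
have xx' : a^-1 * x \in <[x]> by rewrite groupM ?groupV.
rewrite conjMg conjVg xw -aw invMg -mulgA (mulgA a^-1) (df_cent xx' zq) mulKg.
by rewrite [RHS]invMg invgK.
Qed.

(** As [y] and [w] square to 1, [y] inverts [[~ y, w]]; it also inverts the factor [p]. *)
Lemma df_yw_inv p q :
  p \in <[x]> -> q \in <[z]> -> [~ y, w] = p * q -> q ^ y = q^-1.
Proof.
move=> xp zq ywE; have : [~ y, w] ^ y = [~ y, w]^-1.
  have y2 : y * y = 1 by apply: df_y2 dfX.
  have w2 : w * w = 1 by apply: df_w2 dfX.
  have yV : y^-1 = y by apply/eqP; rewrite eq_invg_mul y2.
  have wV : w^-1 = w by apply/eqP; rewrite eq_invg_mul w2.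
  by rewrite /commg /conjg !invMg !invgK yV wV !mulgA y2 mul1g.
rewrite ywE conjMg (df_invx xp) (df_cent xp zq) invMg.
by move/mulgI.
Qed.

Lemma df_expw n1 m1 s b k :
  [~ x, w] = x ^+ (s * n1) * z ^+ (b * m1) ->
  (x ^+ k) ^ w = x ^+ (k * (1 + s * n1)) * z ^+ (k * (b * m1)).
Proof.
move=> xwE; rewrite conjXg -(mulKVg x (x ^ w)) -/(commg x w) xwE mulgA -expgS.
rewrite expgMn; last exact/commuteX2/(df_xz dfX).
by rewrite -!expgM !(mulnC k).
Qed.

(** Comparing [<[x]>]-components gives [x ^+ (k * n1 * (2 + s * n1)) = 1]; then [n1] is cancelled
    from the order of [x]. *)
Lemma df_inv_mod n1 m1 s b k :
  0 < n1 -> n1 %| #[x] ->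
  [~ x, w] = x ^+ (s * n1) * z ^+ (b * m1) ->
  (x ^+ (k * n1)) ^ w = (x ^+ (k * n1))^-1 ->
  (k * (2 + s * n1) = 0 %[mod #[x] %/ n1])%N.
Proof.
move=> n1_gt0 n1x xwE; rewrite (df_expw _ xwE) -[RHS]mulg1.
case/df_uniq; rewrite ?groupV ?mem_cycle ?group1 // => xE _.
apply/eqP; rewrite mod0n -/(_ %| _) -(dvdn_pmul2r n1_gt0) divnK // order_dvdn.
rewrite mulnAC -[2]/(1 + 1)%N -addnA mulnDr expgD muln1 xE mulgV.
by [].
Qed.

(** Both sides say that [x ^+ k] lies in the core of [<[x]>]; the left one states that
    [(x ^+ k) ^ w] has trivial [<[z]>]-component. *)
Lemma df_faithful n1 m1 s b k :
  n1 %| #[x] -> gcore <[x]> X = <[x ^+ n1]> ->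
  [~ x, w] = x ^+ (s * n1) * z ^+ (b * m1) ->
  (z ^+ (k * (b * m1)) == 1) = (n1 %| k).
Proof.
move=> n1x gx xwE; have xkw := df_expw k xwE.
have -> : (n1 %| k) = (x ^+ k \in gcore <[x]> X).
  rewrite gx; apply/idP/idP => [/dvdnP[j ->] | /cycleP[j]].
    by rewrite mulnC expgM mem_cycle.
  move/eqP; rewrite -expgM eq_expg_mod_order => /eqP kj.
  by rewrite /dvdn -(modn_dvdm _ n1x) kj modn_dvdm // modnMr.
apply/eqP/df_gcoreP => [zk1 | [xkx _]].
  by rewrite xkw zk1 mulg1 expgM !mem_cycle.
have : (x ^+ k) ^ w \in <[x]>.
  by apply: subsetP xkx; rewrite cycle_subG mem_cycle.
rewrite xkw => xin.
have := @df_uniq _ 1 _ _ xin (group1 _) (mem_cycle x _) (mem_cycle z _) (mulg1 _).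
by case.
Qed.

End Frame.

Lemma sub_cycle_generator (gT : finGroupType) (x : gT) (M : {group gT}) :
  M \subset <[x]> ->
  exists n1, [/\ 0 < n1, n1 %| #[x] & M :=: <[x ^+ n1]>].
Proof.
move=> sMx; have cMx : #|M| %| #[x] by rewrite orderE cardSg.
exists (#[x] %/ #|M|); split; last 1 first.
- apply/eqP; rewrite (eq_subG_cyclic (cycle_cyclic x)) ?cycle_subG ?mem_cycle //.
  by rewrite -orderE orderXdiv ?dvdn_div // divnA // mulKn.
- by rewrite divn_gt0 ?cardG_gt0 // dvdn_leq // order_gt0.
exact: dvdn_div.
Qed.

Lemma cycle_exponent (gT : finGroupType) (x p : gT) (n1 : nat) :
  n1 %| #[x] -> p \in <[x ^+ n1]> ->
  exists s : 'I_(#[x] %/ n1), p = x ^+ (s * n1).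
Proof.
move=> n1x /cyclePmin[s]; rewrite orderXdiv // => ls ->.
by exists (Ordinal ls); rewrite -expgM mulnC.
Qed.

(** * The presentation *)

Section WordCongruence.

Variables (I : Type) (R : seq (word I * word I)).

Local Notation "u ~~~ v" := (pres_eq R u v) (at level 70).
Local Infix "**" := (@WMul I) (at level 40, left associativity).

#[local] Instance pres_eq_equivalence : Equivalence (pres_eq R).
Proof. by split; [exact: pres_refl | exact: pres_sym | exact: pres_trans]. Qed.

#[local] Instance WMul_proper :
  Proper (pres_eq R ==> pres_eq R ==> pres_eq R) (@WMul I).
Proof. by move=> u u' uu' v v' vv'; exact: pres_mul. Qed.

#[local] Instance WInv_proper : Proper (pres_eq R ==> pres_eq R) (@WInv I).
Proof. by move=> u u' uu'; exact: pres_inv. Qed.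

#[local] Hint Resolve pres_refl : core.

Lemma wmulA u v t : u ** (v ** t) ~~~ u ** v ** t.
Proof. exact: pres_mulA. Qed.

Lemma wmul1 u : WOne ** u ~~~ u. Proof. exact: pres_mul1. Qed.

Lemma wmulV u : WInv u ** u ~~~ WOne. Proof. exact: pres_mulV. Qed.

Lemma wmulVK u v : WInv u ** (u ** v) ~~~ v.
Proof. by rewrite wmulA wmulV wmul1. Qed.

Lemma wmulI u v v' : u ** v ~~~ u ** v' -> v ~~~ v'.
Proof. by move=> uv; rewrite -(wmulVK u v) uv wmulVK. Qed.

(** [pres_eq] postulates only a left unit and left inverses; the right-hand laws follow by left
    cancellation. *)
Lemma wmulV' u : u ** WInv u ~~~ WOne.
Proof.
apply: (@wmulI (WInv u)); rewrite wmulVK.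
by apply: (@wmulI (WInv (WInv u))); rewrite wmulVK wmulV.
Qed.

Lemma wmul1' u : u ** WOne ~~~ u.
Proof. by apply: (@wmulI (WInv u)); rewrite wmulVK wmulV. Qed.

Lemma wmulK u v : (v ** u) ** WInv u ~~~ v.
Proof. by rewrite -wmulA wmulV' wmul1'. Qed.

Lemma wmulI' u v v' : v ** u ~~~ v' ** u -> v ~~~ v'.
Proof. by move=> uv; rewrite -(wmulK u v) uv wmulK. Qed.

Lemma winvM u v : WInv (u ** v) ~~~ WInv v ** WInv u.
Proof. by apply: (@wmulI (u ** v)); rewrite wmulV' wmulA wmulK wmulV'. Qed.

Lemma winvK u : WInv (WInv u) ~~~ u.
Proof. by apply: (@wmulI (WInv u)); rewrite wmulV' wmulV. Qed.

(** [u ^+ 1] is [u] itself and not [u ** WOne], so the case [k = 0] needs the right unit law. *)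
Lemma wexpS u k : u ^+ k.+1 ~~~ u ** u ^+ k.
Proof. by case: k => [|k]; [rewrite wmul1' | exact: pres_refl]. Qed.

Lemma wexpD u k l : u ^+ (k + l) ~~~ u ^+ k ** u ^+ l.
Proof.
elim: k => [|k IHk]; first by rewrite wmul1.
by rewrite addSn !wexpS IHk wmulA.
Qed.

Lemma wexp_dvd u k l : u ^+ k ~~~ WOne -> k %| l -> u ^+ l ~~~ WOne.
Proof.
move=> uk /dvdnP[q ->]; elim: q => [|q IHq]; first exact: pres_refl.
by rewrite mulSn wexpD uk IHq wmul1.
Qed.

Lemma wconj_exp g u u' k : g ** u ~~~ u' ** g -> g ** u ^+ k ~~~ u' ^+ k ** g.
Proof.
move=> gu; elim: k => [|k IHk]; first by rewrite wmul1 wmul1'.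
by rewrite !wexpS wmulA gu -wmulA IHk wmulA.
Qed.

Lemma winv_involution u : u ** u ~~~ WOne -> WInv u ~~~ u.
Proof. by move=> uu; apply: (@wmulI u); rewrite wmulV' uu. Qed.

(** For an involution [v], the relation [u ^ v = t] becomes a rule that moves [v] rightwards past
    [u]. *)
Lemma wconj_swap u v t :
  v ** v ~~~ WOne -> WInv v ** (u ** v) ~~~ t -> v ** u ~~~ t ** v.
Proof. by move=> vv <-; rewrite -!wmulA vv wmul1' (winv_involution vv). Qed.

Lemma wcomm_swap u v t :
  v ** v ~~~ WOne -> WInv u ** (WInv v ** (u ** v)) ~~~ t ->
  v ** u ~~~ (u ** t) ** v.
Proof.
by move=> vv <-; apply: wconj_swap vv _; rewrite [u ** (_ ** _)]wmulA wmulV' wmul1.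
Qed.

Section Translations.

Variables x z : word I.
Hypothesis xz : x ** z ~~~ z ** x.

(** These words stand for the elements of [N]; natural exponents suffice once [wexp_inv] makes
    inverses of generators into powers. *)
Definition translation u := exists i j, u ~~~ x ^+ i ** z ^+ j.

#[local] Instance translation_proper : Proper (pres_eq R ==> iff) translation.
Proof. by move=> u u' uu'; split=> -[i [j uE]]; exists i, j; rewrite -uE uu'. Qed.

Lemma translation_intro i j : translation (x ^+ i ** z ^+ j).
Proof. by exists i, j. Qed.

Lemma translationx i : translation (x ^+ i).
Proof. by exists i, 0%N; rewrite wmul1'. Qed.

Lemma translationz i : translation (z ^+ i).
Proof. by exists 0%N, i; rewrite wmul1. Qed.

Lemma wmul_translation i j i' j' :
  (x ^+ i ** z ^+ j) ** (x ^+ i' ** z ^+ j') ~~~ x ^+ (i + i') ** z ^+ (j + j').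
Proof.
rewrite !wexpD -!wmulA; apply: pres_mul; first exact: pres_refl.
rewrite !wmulA; apply: pres_mul; last exact: pres_refl.
apply: pres_sym; apply: wconj_exp; apply: pres_sym.
by apply: wconj_exp; apply: pres_sym.
Qed.

Lemma translationM u v : translation u -> translation v -> translation (u ** v).
Proof.
move=> [i [j ->]] [i' [j' ->]]; rewrite wmul_translation.
exact: translation_intro.
Qed.

Lemma translation_exp u k : translation u -> translation (u ^+ k).
Proof.
move=> Tu; elim: k => [|k IHk]; first exact: (translationx 0).
by rewrite wexpS; apply: translationM.
Qed.

Lemma translation_swap g u v t :
  g ** x ~~~ u ** g -> g ** z ~~~ v ** g -> translation u -> translation v ->
  translation t -> exists2 t', translation t' & g ** t ~~~ t' ** g.
Proof.
move=> gx gz Tu Tv [i [j tE]]; exists (u ^+ i ** v ^+ j).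
  by apply: translationM; apply: translation_exp.
by rewrite tE wmulA (wconj_exp i gx) -wmulA (wconj_exp j gz) wmulA.
Qed.

End Translations.

Definition normal_form x y z w u :=
  exists t e f, translation x z t /\
    u ~~~ t ** ((if e then y else WOne) ** (if f then w else WOne)).

Section NormalForms.

Variables (x y z w : word I) (n m : nat).
Hypotheses (n_gt0 : 0 < n) (m_gt0 : 0 < m).
Hypotheses (xn : x ^+ n ~~~ WOne) (zm : z ^+ m ~~~ WOne).
Hypotheses (yy : y ** y ~~~ WOne) (ww : w ** w ~~~ WOne).
Hypothesis xz : x ** z ~~~ z ** x.
Variables p q r s t : word I.
Hypotheses (Tp : translation x z p) (yx : y ** x ~~~ p ** y).
Hypotheses (Tq : translation x z q) (yz : y ** z ~~~ q ** y).
Hypotheses (Tr : translation x z r) (wx : w ** x ~~~ r ** w).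
Hypotheses (Ts : translation x z s) (wz : w ** z ~~~ s ** w).
Hypotheses (Tt : translation x z t) (wy : w ** y ~~~ t ** (y ** w)).

Let NF := normal_form x y z w.

Lemma nf_translation u v : translation x z u -> NF v -> NF (u ** v).
Proof.
move=> Tu [k [e [f [Tk vE]]]]; exists (u ** k), e, f.
by split; [exact: translationM | rewrite vE wmulA].
Qed.

Lemma nf_y v : NF v -> NF (y ** v).
Proof.
move=> [k [e [f [Tk vE]]]].
have [k' Tk' yk] := translation_swap xz yx yz Tp Tq Tk.
exists k', (~~ e), f; split=> //; rewrite vE wmulA yk -wmulA.
by case: e {vE} => /=; [rewrite (wmulA y y) yy | rewrite wmul1].
Qed.

Lemma nf_w v : NF v -> NF (w ** v).
Proof.
move=> [k [e [f [Tk vE]]]].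
have [k' Tk' wk] := translation_swap xz wx wz Tr Ts Tk.
case: e vE => vE; last first.
  exists k', false, (~~ f); split=> //; rewrite vE wmulA wk -wmulA !wmul1.
  by case: f {vE} => /=; rewrite ?ww ?wmul1'.
(* Moving [w] past [y] leaves the extra translation [t]. *)
exists (k' ** t), true, (~~ f); split; first exact: translationM.
rewrite vE wmulA wk -!wmulA (wmulA w y) wy -!wmulA.
by case: f {vE} => /=; rewrite ?ww ?wmul1'.
Qed.

Lemma wexp_inv u k : 0 < k -> u ^+ k ~~~ WOne -> WInv u ~~~ u ^+ k.-1.
Proof.
move=> k_gt0 uk; apply: (@wmulI u); rewrite wmulV' -uk -{1}(prednK k_gt0).
exact: wexpS.
Qed.

Lemma nf_proper u v : u ~~~ v -> NF v -> NF u.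
Proof.
by move=> uv [k [e [f [Tk vE]]]]; exists k, e, f; split=> //; rewrite uv.
Qed.

End NormalForms.

End WordCongruence.

Lemma word_normal_form (R : seq (word gen4 * word gen4)) (n m : nat) :
  let x := WGen GX in let y := WGen GY in
  let z := WGen GZ in let w := WGen GW in
  forall p q r s t : word gen4,
  0 < n -> 0 < m -> pres_eq R (x ^+ n) 1 -> pres_eq R (z ^+ m) 1 ->
  pres_eq R (y * y) 1 -> pres_eq R (w * w) 1 -> pres_eq R (x * z) (z * x) ->
  translation R x z p -> pres_eq R (y * x) (p * y) ->
  translation R x z q -> pres_eq R (y * z) (q * y) ->
  translation R x z r -> pres_eq R (w * x) (r * w) ->
  translation R x z s -> pres_eq R (w * z) (s * w) ->
  translation R x z t -> pres_eq R (w * y) (t * (y * w)) ->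
  forall u, normal_form R x y z w u.
Proof.
move=> x y z w p q r s t n0 m0 xn zm yy ww xz Tp yx Tq yz Tr wx Ts wz Tt wy.
have nfP := nf_proper.
(* [u] acts on normal forms from the left. Treating [u] and [u^-1] together lets the induction pass
   through inverses of products. *)
have step u v : normal_form R x y z w v ->
    normal_form R x y z w (u * v) /\ normal_form R x y z w (u^-1 * v).
  elim: u v => [g | | u1 IH1 u2 IH2 | u IH] v NFv.
  - have nfx i := nf_translation xz (translationx R x z i) NFv.
    have nfz i := nf_translation xz (translationz R x z i) NFv.
    have nfy := nf_y yy xz Tp yx Tq yz NFv.
    have nfw := nf_w ww xz Tr wx Ts wz Tt wy NFv.
    case: g; split=> //.
    + exact: (nfx 1%N).
    + apply: nfP (nfx n.-1); apply: pres_mul (pres_refl _ _).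
      exact: wexp_inv.
    + apply: nfP nfy; apply: pres_mul (pres_refl _ _).
      exact: (wexp_inv (k := 2)).
    + exact: (nfz 1%N).
    + apply: nfP (nfz m.-1); apply: pres_mul (pres_refl _ _).
      exact: wexp_inv.
    apply: nfP nfw; apply: pres_mul (pres_refl _ _).
    exact: (wexp_inv (k := 2)).
  - split; first exact: nfP (pres_mul1 _ _) NFv.
    apply: nfP NFv; apply: pres_trans (pres_mul1 R v).
    apply: pres_mul (pres_refl _ _); apply: pres_trans (pres_mulV R 1).
    exact/pres_sym/wmul1'.
  - split.
      apply: nfP (pres_sym (pres_mulA R u1 u2 v)) _.
      by have [/IH1[]] := IH2 v NFv.
    have [_ /IH2[_ NFv21]] := IH1 v NFv; apply: nfP NFv21.
    apply: pres_trans (pres_sym (pres_mulA _ _ _ _)).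
    by apply: pres_mul (pres_refl _ _); apply: winvM.
  have [NFu NFu'] := IH v NFv; split=> //.
  by apply: nfP NFu; apply: pres_mul (pres_refl _ _); apply: winvK.
move=> u; have NF1 : normal_form R x y z w 1.
  exists 1, false, false; split; first exact: (translationx R x z 0).
  exact/pres_sym/(pres_trans (pres_mul1 _ _) (pres_mul1 _ _)).
have [NFu _] := step u 1 NF1; apply: nfP NFu.
exact/pres_sym/wmul1'.
Qed.

(** * Evaluation of words, soundness and completeness of the relations *)

Lemma wevalX (I : Type) (gT : finGroupType) (f : I -> gT) (u : word I) k :
  weval f (u ^+ k) = weval f u ^+ k.
Proof.
elim: k => // -[|k] IHk //.
by rewrite expgS -IHk.
Qed.

Lemma weval_sound (I : Type) (gT : finGroupType) (f : I -> gT)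
    (R : seq (word I * word I)) :
  (forall u v, List.In (u, v) R -> weval f u = weval f v) ->
  forall u v, pres_eq R u v -> weval f u = weval f v.
Proof.
move=> fR u v; elim=> {u v} //=.
- by move=> u v t _ -> _ ->.
- by move=> u u' v v' _ -> _ ->.
- by move=> u u' _ ->.
- by move=> u v t; rewrite mulgA.
- by move=> u; rewrite mul1g.
by move=> u; rewrite mulVg.
Qed.

Section Presentation.

Variables (n m n1 m1 a b c r s t : nat).
Hypotheses (n_gt0 : 0 < n) (m_gt0 : 0 < m).

Let R := dihedral_relations n m n1 m1 a b c r s t.

Local Notation "u ~~~ v" := (pres_eq R u v) (at level 70).
Local Infix "**" := (@WMul gen4) (at level 40, left associativity).
#[local] Hint Resolve pres_refl : core.
#[local] Existing Instance pres_eq_equivalence.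
#[local] Existing Instance WMul_proper.
#[local] Existing Instance WInv_proper.

Let x := WGen GX. Let y := WGen GY. Let z := WGen GZ. Let w := WGen GW.

Lemma dihedral_normal_form u : normal_form R x y z w u.
Proof.
have xn : x ^+ n ~~~ WOne by apply: pres_rel; left.
have yy : y ** y ~~~ WOne by apply: pres_rel; right; left.
have zm : z ^+ m ~~~ WOne by apply: pres_rel; do 2!right; left.
have ww : w ** w ~~~ WOne by apply: pres_rel; do 3!right; left.
have xzE : [~ x, z] ~~~ WOne by apply: pres_rel; do 4!right; left.
have xyE : x ^ y ~~~ WInv x by apply: pres_rel; do 5!right; left.
have zwE : z ^ w ~~~ WInv z by apply: pres_rel; do 6!right; left.
have xwE : [~ x, w] ~~~ x ^+ (s * n1) ** z ^+ (b * m1).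
  by apply: pres_rel; do 7!right; left.
have zyE : [~ z, y] ~~~ x ^+ (r * n1) ** z ^+ (a * m1).
  by apply: pres_rel; do 8!right; left.
have ywE : [~ y, w] ~~~ x ^+ (t * n1) ** z ^+ (c * m1).
  by apply: pres_rel; do 9!right; left.
have xz : x ** z ~~~ z ** x.
  by move: xzE; rewrite -(wmulV R x) => /wmulI/pres_sym;
     rewrite -{1}(wmulVK R z x) => /wmulI/pres_sym.
have Tx := translationx R x z 1; have Tz := translationz R x z 1.
have Tint i j : translation R x z (x ^+ i ** z ^+ j) by exists i, j.
have Tconj u1 v1 : WInv u1 ~~~ v1 -> translation R x z v1 ->
    translation R x z (WInv u1).
  by move=> uv [i [j v1E]]; exists i, j; rewrite uv.
have xV := wexp_inv n_gt0 xn; have zV := wexp_inv m_gt0 zm.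
have TxV := Tconj _ _ xV (translationx R x z _).
have TzV := Tconj _ _ zV (translationz R x z _).
have yx := wconj_swap yy xyE; have wz := wconj_swap ww zwE.
have wx := wcomm_swap ww xwE; have yz := wcomm_swap yy zyE.
have wy := wcomm_swap ww ywE.
have Tyz := translationM xz Tz (Tint (r * n1)%N (a * m1)%N).
have Twx := translationM xz Tx (Tint (s * n1)%N (b * m1)%N).
(* The relation for [[~ y, w]] leaves a translation between [y] and [w]; moved in front of [y], it
   becomes [t']. *)
have [t' Tt' yt'] := translation_swap xz yx yz TxV Tyz (Tint (t * n1)%N (c * m1)%N).
have {}wy : w ** y ~~~ t' ** (y ** w) by rewrite wmulA -yt'.
exact: (word_normal_form n_gt0 m_gt0 xn zm yy ww xz TxV yx Tyz yz Twx wx TzV wz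
  Tt' wy).
Qed.

End Presentation.

Lemma weval_gen (I : Type) (gT : finGroupType) (f : I -> gT) (A : {set gT}) :
  (forall i, f i \in A) -> {in A, forall g, exists i, f i = g} ->
  forall g, g \in <<A>> <-> exists u, weval f u = g.
Proof.
move=> fA Af g; split=> [/gen_prodgP[k [c cA ->]] | [u <-]].
  elim/big_ind: _ => [|_ _ [u <-] [v <-]|i _]; first by exists WOne.
    by exists (WMul u v).
  by have [j <-] := Af _ (cA i); exists (WGen j).
elim: u => /= [i||u IHu v IHv|u IHu]; rewrite ?group1 ?groupM ?groupV //.
exact: mem_gen.
Qed.

(** For completeness, a word of value 1 is put in normal form. Its part in [y] and [w] evaluates
    into [N], hence is empty; uniqueness of components then makes the powers of [x] and [z] trivial,
    and the order relations remove them. *)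
Lemma frame_presentation (gT : finGroupType) (X N : {group gT})
    (x y z w : gT) (n1 m1 a b c r s t : nat) :
  dihedral_frame X N x y z w -> y \notin N -> w \notin N -> y * w \notin N ->
  [~ x, w] = x ^+ (s * n1) * z ^+ (b * m1) ->
  [~ z, y] = x ^+ (r * n1) * z ^+ (a * m1) ->
  [~ y, w] = x ^+ (t * n1) * z ^+ (c * m1) ->
  has_presentation X (assign4 x y z w)
    (dihedral_relations #[x] #[z] n1 m1 a b c r s t).
Proof.
move=> dfX N'y N'w N'yw xwE zyE ywE; split=> [g|].
  rewrite -(df_gen dfX); apply: weval_gen; first by case; rewrite !inE eqxx ?orbT.
  move=> h; rewrite !inE -!orbA => /or4P[] /eqP->.
  - by exists GX.
  - by exists GY.
  - by exists GZ.
  by exists GW.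
set f := assign4 x y z w; set R := dihedral_relations _ _ _ _ _ _ _ _ _ _.
have sound u v : pres_eq R u v -> weval f u = weval f v.
  apply: weval_sound => {}u {}v.
  case=> [[<- <-]|]; first by rewrite wevalX expg_order.
  case=> [[<- <-]|]; first exact: (df_y2 dfX).
  case=> [[<- <-]|]; first by rewrite wevalX expg_order.
  case=> [[<- <-]|]; first exact: (df_w2 dfX).
  case=> [[<- <-]|]; first exact/eqP/commgP/(df_xz dfX).
  case=> [[<- <-]|]; first exact: (df_xy dfX).
  case=> [[<- <-]|]; first exact: (df_zw dfX).
  case=> [[<- <-]|].
    by rewrite -[LHS]/[~ x, w] xwE -[RHS]/(weval f _ * weval f _) !wevalX.
  case=> [[<- <-]|].
    by rewrite -[LHS]/[~ z, y] zyE -[RHS]/(weval f _ * weval f _) !wevalX.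
  case=> [[<- <-]|//].
  by rewrite -[LHS]/[~ y, w] ywE -[RHS]/(weval f _ * weval f _) !wevalX.
suff complete u : weval f u = 1 -> pres_eq R u 1.
  move=> u v; split=> [uv | /sound //].
  apply: (@wmulI' _ R (WInv v)).
  apply: pres_trans (pres_sym (wmulV' R v)); apply: complete.
  by rewrite /= uv mulgV.
have [k [e [d [[i [j kE]] uE]]]] :=
  dihedral_normal_form n1 m1 a b c r s t (order_gt0 x) (order_gt0 z) u.
rewrite (sound _ _ uE) /= (sound _ _ kE) /= !wevalX /= => ed1.
have Nxz : x ^+ i * z ^+ j \in N by rewrite -(df_mul dfX) mem_mulg ?mem_cycle.
have {}ed1 : weval f (if e then WGen GY else WOne) *
    weval f (if d then WGen GW else WOne) = (x ^+ i * z ^+ j)^-1.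
  by apply/eqP; rewrite eq_sym eq_invg_mul ed1.
have [e0 d0] : e = false /\ d = false.
  have := Nxz; rewrite -groupV -ed1.
  by case: e d {ed1 uE} => -[]; rewrite /= ?mulg1 ?mul1g
    ?(negPf N'y) ?(negPf N'w) ?(negPf N'yw).
move: ed1 uE; rewrite e0 d0 /= mulg1 => /esym/eqP; rewrite invg_eq1 => /eqP xz1 uE.
have [x1 z1] := df_uniq dfX (mem_cycle x i) (mem_cycle z j) (group1 _) (group1 _)
  (etrans xz1 (esym (mulg1 1))).
have Rx : pres_eq R (WGen GX ^+ #[x]) 1 by apply: pres_rel; left.
have Rz : pres_eq R (WGen GZ ^+ #[z]) 1 by apply: pres_rel; right; right; left.
apply: pres_trans uE _; apply: pres_trans (pres_mul kE (pres_mul1 _ _)) _.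
apply: pres_trans (wmul1' _ _) _; apply: pres_trans (pres_mul1 R 1).
by apply: pres_mul; [apply: wexp_dvd Rx _ | apply: wexp_dvd Rz _];
   rewrite order_dvdn ?x1 ?z1.
Qed.

(** * Conditions over the integers and assembly of the presentation *)

Lemma int_mul_modP (d e b : nat) :
  (forall k : nat, (d %| b * k)%N = (e %| k)%N) ->
  forall k : int, (b%:Z * k = 0 %[mod d%:Z])%Z <-> (k = 0 %[mod e%:Z])%Z.
Proof.
move=> bP k; have P (f : nat) l : (l = 0 %[mod f%:Z])%Z <-> (f %| `|l|)%N.
  by rewrite mod0z -[(_ %| _)%N]/(dvdz f l); split=> [/dvdz_mod0P|/dvdz_mod0P].
by rewrite !P abszM absz_nat bP.
Qed.

Lemma df_faithfulZ (gT : finGroupType) (X N : {group gT}) (x y z w : gT)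
    (n1 m1 s b : nat) :
  dihedral_frame X N x y z w -> n1 %| #[x] -> 0 < m1 -> m1 %| #[z] ->
  gcore <[x]> X = <[x ^+ n1]> ->
  [~ x, w] = x ^+ (s * n1) * z ^+ (b * m1) ->
  forall k : int, (b%:Z * k = 0 %[mod (#[z] %/ m1)%N%:Z])%Z <->
    (k = 0 %[mod n1%:Z])%Z.
Proof.
move=> dfX n1x m1_gt0 m1z gx xwE; apply: int_mul_modP => k.
rewrite -(df_faithful dfX k n1x gx xwE) -order_dvdn.
by rewrite -(dvdn_pmul2r m1_gt0) divnK // mulnAC mulnC.
Qed.

Theorem theorem1 (n m : nat) (gT : finGroupType) (X H K : {group gT})
    (x y z w : gT)
    (hn : (3 <= n)%N) (n_odd : odd n) (hm : (3 <= m)%N) (m_odd : odd m)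
    (hX : exact_product X H K)
    (hH : dihedral_on n x y H) (hK : dihedral_on m z w K) :
  exists (m1 n1 : nat) (a b c : 'I_(m %/ m1)) (r s t : 'I_(n %/ n1)),
    [/\ (0 < m1)%N /\ (m1 %| m)%N, (0 < n1)%N /\ (n1 %| n)%N,
        gcore <[z]> X = <[z ^+ m1]>
      & gcore <[x]> X = <[x ^+ n1]>] /\
    [/\ has_presentation X (assign4 x y z w)
          (dihedral_relations n m n1 m1 a b c r s t),
        [/\ a * (2 + a * m1) = 0 %[mod m %/ m1],
            b * (2 + a * m1) = 0 %[mod m %/ m1]
          & c * (2 + a * m1) = 0 %[mod m %/ m1]]%N,
        [/\ r * (2 + s * n1) = 0 %[mod n %/ n1],
            s * (2 + s * n1) = 0 %[mod n %/ n1]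
          & t * (2 + s * n1) = 0 %[mod n %/ n1]]%N,
        forall k : int,
          (b%:Z * k = 0 %[mod (m %/ m1)%N%:Z])%Z <-> (k = 0 %[mod n1%:Z])%Z
      & forall k : int,
          (r%:Z * k = 0 %[mod (n %/ n1)%N%:Z])%Z <-> (k = 0 %[mod m1%:Z])%Z].
Proof.
have [N [nNX oddN defN cxz ywN]] := exact_product_dihedral n_odd m_odd hX hH hK.
have [defX tiHK] := hX.
have [defH ox oy xy] := hH; have [defK oz ow zw] := hK.
have [_ defxy _ tixy] := sdprodP defH; have [_ defzw _ tizw] := sdprodP defK.
have sxH : <[x]> \subset H by rewrite -defxy mulG_subl.
have szK : <[z]> \subset K by rewrite -defzw mulG_subl.
have Hy : y \in H by rewrite -cycle_subG -defxy mulG_subr.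
have Kw : w \in K by rewrite -cycle_subG -defzw mulG_subr.
have tixz : <[x]> :&: <[z]> = 1.
  by apply/trivgP; rewrite -tiHK setISS.
have genX : <<[set x; y; z; w]>> = X.
  apply/eqP; rewrite eqEsubset gen_subG; apply/andP; split.
    have sHX : H \subset X by rewrite -defX mulG_subl.
    have sKX : K \subset X by rewrite -defX mulG_subr.
    rewrite !subUset !sub1set (subsetP sHX y) // (subsetP sKX w) //.
    by rewrite -!cycle_subG (subset_trans sxH) ?(subset_trans szK).
  rewrite -{1}defX -defxy -defzw !mul_subG // cycle_subG mem_gen //;
  by rewrite !inE eqxx ?orbT.
have dfX : dihedral_frame X N x y z w.
  split=> //; first exact: normal_norm.
    by rewrite -oy expg_order.
  by rewrite -ow expg_order.
have dfX' := dihedral_frameC dfX.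
have not_inN g : #[g] = 2 -> g \notin N.
  by move=> og; apply: contraL oddN => Ng; rewrite -dvdn2 -og order_dvdG.
(* From [y * w = p * q], the element [p^-1 * y = q * w^-1] lies in [H :&: K = 1], which would put
   [y] in [<[x]>]. *)
have N'yw : y * w \notin N.
  apply/negP; rewrite -defN => /mulsgP[p q xp zq yw].
  have pyE : p^-1 * y = q * w^-1.
    by apply: (mulgI p); rewrite mulKVg mulgA -yw mulgK.
  have : p^-1 * y \in H :&: K.
    rewrite inE {2}pyE !groupM ?groupV //.
      exact: (subsetP szK).
    exact: (subsetP sxH).
  rewrite tiHK => /set1P/eqP; rewrite -eq_invg_mul invgK => /eqP py.
  have : y \in <[x]> :&: <[y]> by rewrite inE cycle_id -py xp.
  by rewrite tixy => /set1P y1; move: oy; rewrite y1 order1.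
subst n m.
have [n1 [n1_gt0 n1x gx]] := sub_cycle_generator (gcore_sub <[x]> X).
have [m1 [m1_gt0 m1z gz]] := sub_cycle_generator (gcore_sub <[z]> X).
have decomp g : g \in N -> exists p q, [/\ p \in <[x]>, q \in <[z]> & g = p * q].
  by rewrite -defN => /mulsgP[p q xp zq ->]; exists p, q.
have commN g h : g \in N -> h \in X -> [~ g, h] \in N.
  by move=> Ng Xh; rewrite groupM ?groupV // memJ_norm // (subsetP (normal_norm nNX)).
have [p1 [q1 [xp1 zq1 xwE]]] : exists p q,
    [/\ p \in <[x]>, q \in <[z]> & [~ x, w] = p * q].
  apply/decomp/commN; last by rewrite -genX mem_gen // !inE eqxx ?orbT.
  by rewrite (subsetP (df_subx dfX)) ?cycle_id.
have [p2 [q2 [xp2 zq2 zyE]]] : exists p q,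
    [/\ p \in <[x]>, q \in <[z]> & [~ z, y] = p * q].
  apply/decomp/commN; last by rewrite -genX mem_gen // !inE eqxx ?orbT.
  by rewrite (subsetP (df_subz dfX)) ?cycle_id.
have [p3 [q3 [xp3 zq3 ywE]]] := decomp _ ywN.
have [q1y p1w] := df_xw dfX xp1 zq1 xwE.
have zyE' : [~ z, y] = q2 * p2 by rewrite zyE (df_cent dfX xp2 zq2).
have [p2w q2y] := df_xw dfX' zq2 xp2 zyE'.
have q3y := df_yw_inv dfX xp3 zq3 ywE.
have wyE : [~ w, y] = q3^-1 * p3^-1 by rewrite -invg_comm ywE invMg.
(* In the exchanged frame the relevant commutator is [[~ w, y]], whose components are [q3^-1] and
   [p3^-1]. *)
have p3w : p3 ^ w = p3^-1.
  apply: invg_inj; rewrite -conjVg.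
  exact: (df_yw_inv dfX' (groupVr zq3) (groupVr xp3) wyE).
have expx p : p \in <[x]> -> p ^ w = p^-1 ->
    exists s : 'I_(#[x] %/ n1), p = x ^+ (s * n1).
  by move=> xp pw; apply: cycle_exponent; rewrite // -gx (df_gcore_inv dfX).
have expz q : q \in <[z]> -> q ^ y = q^-1 ->
    exists a : 'I_(#[z] %/ m1), q = z ^+ (a * m1).
  by move=> zq qy; apply: cycle_exponent; rewrite // -gz (df_gcore_inv dfX').
have [s p1E] := expx _ xp1 p1w; have [b q1E] := expz _ zq1 q1y.
have [r p2E] := expx _ xp2 p2w; have [a q2E] := expz _ zq2 q2y.
have [t p3E] := expx _ xp3 p3w; have [c q3E] := expz _ zq3 q3y.
rewrite p1E q1E in xwE; rewrite p2E q2E in zyE zyE'; rewrite p3E q3E in ywE.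
rewrite p1E in p1w; rewrite p2E in p2w; rewrite p3E in p3w.
rewrite q1E in q1y; rewrite q2E in q2y; rewrite q3E in q3y.
(* The factor [2 + s * n1] is common to [r], [s] and [t]: it describes [w] on [<[x]>], where all
   three components are inverted. *)
have invx k := df_inv_mod (k := k) dfX n1_gt0 n1x xwE.
have invz k := df_inv_mod (k := k) dfX' m1_gt0 m1z zyE'.
exists m1, n1, a, b, c, r, s, t; split=> //; split.
- exact: (frame_presentation dfX (not_inN y oy) (not_inN w ow) N'yw xwE zyE ywE).
- by split; apply: invz.
- by split; apply: invx.
- exact: (df_faithfulZ dfX n1x m1_gt0 m1z gx xwE).
exact: (df_faithfulZ dfX' m1z n1_gt0 n1x gz zyE').
Qed.
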